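(* Let $G=(V,E)$ be a self-centered $(D,L)$-Bonnet-Myers sharp graph. Then $G$ is Bakry-Émery $\infty$-curvature sharp at all vertices $x\in V$, and for all $x\in V$ $$\mathcal K^{\mathrm n}_{G,x}(\infty)=\frac1D+\frac1L.$$
   Context: All graphs are finite, simple, undirected, unweighted, connected, and have at least one edge. $d$ denotes the combinatorial distance and $\mathrm{diam}(G)=\max_{x,y}d(x,y)$; $x\sim y$ means that $x,y$ are adjacent. A graph $G$ is self-centered if for every vertex $x$ there is a vertex $\overline x$ with $d(x,\overline x)=\mathrm{diam}(G)$. For a $D$-regular graph $G=(V,E)$ and $x\in V$, let $\mu_x$ be the probability measure on $V$ giving mass $\frac1{D+1}$ to $x$ and to each of its $D$ neighbours. The Wasserstein distance of probability measures $\mu,\nu$ on $V$ is $W_1(\mu,\nu)=\inf_\pi\sum_{u,v\in V}d(u,v)\pi(u,v)$, where $\pi:V\times V\to[0,1]$ runs over all couplings with marginals $\mu$ and $\nu$. The (modified) Ollivier Ricci curvature of two different vertices $x,y$ is $$\kappa(x,y)=\frac{D+1}{D}\left(1-\frac{W_1(\mu_x,\mu_y)}{d(x,y)}\right).$$ A $D$-regular graph $G$ of diameter $L$ is called $(D,L)$-Bonnet-Myers sharp if $\inf_{x\sim y}\kappa(x,y)=\frac2L$. Normalized Bakry-Émery $\infty$-curvature: let $\Delta f(x)=\frac1D\sum_{y\sim x}(f(y)-f(x))$ for $f:V\to\mathbb R$, and $2\Gamma(f,g)=\Delta(fg)-f\Delta g-g\Delta f$, $2\Gamma_2(f,g)=\Delta\Gamma(f,g)-\Gamma(f,\Delta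 g)-\Gamma(\Delta f,g)$, $\Gamma(f)=\Gamma(f,f)$, $\Gamma_2(f)=\Gamma_2(f,f)$. Then $\mathcal K^{\mathrm n}_{G,x}(\infty)$ is the largest real number $\mathcal K$ such that $\Gamma_2(f)(x)\ge\mathcal K\,\Gamma(f)(x)$ for all $f:V\to\mathbb R$. For every $D$-regular graph one has $\mathcal K^{\mathrm n}_{G,x}(\infty)\le\frac2D+\frac{\#_\Delta(x)}{D^2}$, where $\#_\Delta(x)$ is the number of triangles containing $x$; $G$ is called (Bakry-Émery) $\infty$-curvature sharp at $x$ if equality holds here. *)

(* Defs.v *)
From HB Require Import structures.
From mathcomp Require Import all_boot all_order all_algebra.
From mathcomp Require Import classical_sets reals.
Set Implicit Arguments.
Unset Strict Implicit.
Unset Printing Implicit Defensive.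
Import Order.TTheory GRing.Theory Num.Theory.
Local Open Scope ring_scope.

Section Graph.
Variables (V : finType) (e : rel V).

Definition connected_graph : Prop :=
  [/\ symmetric e, irreflexive e, (forall x y, connect e x y)
    & exists x y, e x y].

Definition walk_of_length (x y : V) (n : nat) : bool :=
  [exists p : n.-tuple V, path e x p && (last x p == y)].

(* [find] returns the least n < #|V| admitting a walk of length n; the default
   value #|V| is only reached when y is not reachable from x. *)
Definition gdist (x y : V) : nat :=
  find (walk_of_length x y) (iota 0 #|V|).

Lemma gdist_walk x y : connect e x y -> walk_of_length x y (gdist x y).
Proof.
move=> /connectP [p0 ep0 ->]; case/shortenP: ep0 => p ep up _.
have szp : (size p < #|V|)%N by have := max_card (mem (x :: p)); rewrite (card_uniqP up).
have hs : has (walk_of_length x (last x p)) (iota 0 #|V|).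
  apply/hasP; exists (size p); first by rewrite mem_iota.
  by apply/existsP; exists (in_tuple p); rewrite /= ep eqxx.
have := nth_find 0%N hs; rewrite nth_iota ?add0n //.
by move: hs; rewrite has_find size_iota.
Qed.

Lemma gdist_min x y p :
  path e x p -> last x p = y -> (gdist x y <= size p)%N.
Proof.
move=> ep lp; rewrite leqNgt; apply/negP => lt_p.
have szV : (size p < #|V|)%N.
  by apply: leq_trans lt_p _; have := find_size (walk_of_length x y) (iota 0 #|V|); rewrite size_iota.
have := before_find 0%N lt_p; rewrite nth_iota // add0n.
by move/existsP; apply; exists (in_tuple p); rewrite /= ep lp eqxx.
Qed.

Definition diam : nat := \max_(x : V) \max_(y : V) gdist x y.

Definition self_centered : Prop :=
  forall x : V, exists xbar : V, gdist x xbar = diam.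

Definition regular (D : nat) : Prop := forall x : V, #|[set y | e x y]| = D.

Definition triangles (x : V) : {set {set V}} :=
  [set A : {set V} | [&& x \in A, #|A| == 3%N
    & [forall y in A, forall z in A, (y != z) ==> e y z]]].

Section Curvature.
Variables (R : realType) (D : nat).

Definition lazy_measure (x : V) : V -> R :=
  fun u => if (u == x) || e x u then D.+1%:R^-1 else 0.

Definition coupling (mu nu : V -> R) : set (V -> V -> R) :=
  [set p : V -> V -> R | [/\ forall u v, 0 <= p u v <= 1,
               forall u, \sum_v p u v = mu u
             & forall v, \sum_u p u v = nu v]]%classic.

Definition transport_cost (p : V -> V -> R) : R :=
  \sum_u \sum_v (gdist u v)%:R * p u v.

Definition W1 (mu nu : V -> R) : R :=
  inf [set transport_cost p | p in coupling mu nu]%classic.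

Definition kappa (x y : V) : R :=
  (D.+1%:R / D%:R) *
  (1 - W1 (lazy_measure x) (lazy_measure y) / (gdist x y)%:R).

Definition Bonnet_Myers_sharp (L : nat) : Prop :=
  [/\ regular D, diam = L
    & inf [set k : R | exists x y, e x y /\ k = kappa x y]%classic = 2 / L%:R].

Definition laplacian (f : V -> R) : V -> R :=
  fun x => D%:R^-1 * \sum_(y | e x y) (f y - f x).

Definition Gamma (f g : V -> R) : V -> R := fun x =>
  (laplacian (fun z => f z * g z) x - f x * laplacian g x
   - g x * laplacian f x) / 2.

Definition Gamma2 (f g : V -> R) : V -> R := fun x =>
  (laplacian (Gamma f g) x - Gamma f (laplacian g) x
   - Gamma (laplacian f) g x) / 2.

Definition BE_bounds (x : V) : set R :=
  [set K : R | forall f : V -> R, Gamma2 f f x >= K * Gamma f f x]%classic.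

(* The curvature is specified as a greatest element, so that the statement
   "the curvature at x is K" includes that the maximum exists. *)
Definition is_BE_curvature (x : V) (K : R) : Prop :=
  BE_bounds x K /\ ubound (BE_bounds x) K.

Definition BE_curvature_sharp (x : V) : Prop :=
  is_BE_curvature x (2 / D%:R + #|triangles x|%:R / D%:R ^+ 2).

End Curvature.
End Graph.

(* Main.v *)
Require Import Defs.
From HB Require Import structures.
From mathcomp Require Import all_boot all_order all_algebra.
From mathcomp Require Import boolp classical_sets reals.
From mathcomp Require Import zify ring lra.
Set Implicit Arguments.
Unset Strict Implicit.
Unset Printing Implicit Defensive.
Import Order.TTheory GRing.Theory Num.Theory.
Local Open Scope ring_scope.

(** The proof reads a sharp curvature bound through test functions.  For an
edge xy, optimal transport dominates the increment of every 1-Lipschitz g, so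
the hypothesis says that the sum of g over the closed ball grows by at most
c = D + 1 - 2D/L from x to y ([ball_sum_edge_le]).

Apply this along a geodesic from x to an antipode xb, to g = d(x, .): the ball
sum has to grow by L c in L steps, so every step is extremal.  The same holds
with x and xb exchanged, and comparing both shows that the interval from x to
xb is closed under taking neighbours, hence is the whole graph.  So
d(x, .) is extremal across every edge that increases it: its ball sum at y is
D + d(x, y) c, for all x and y ([ball_sum_gdist]).  In particular every edge
lies in t = 2D/L - 2 triangles ([common_neighbours]).

Since distance functions are extremal, no small modification of them may
increase the growth.  Lowering or raising a distance function near a few
vertices gives the local geometry: if a and y are neighbours of x with a, y
distinct and not adjacent, then exactly one common neighbour of a and y lies
outside the ball of x ([edge_square_exists], [edge_square_unique]).

On the Bakry-Emery side, 4 D^2 Gamma2(f)(x) is the sum of the squares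
(f z - 2 f y + f x)^2 over the walks x ~ y ~ z, minus the sum of
(f y - f z)^2 over pairs of neighbours y, z of x ([Gamma2E]).  The walks that
return to x contribute 4 sum_y (f y - f x)^2, the walks that stay at
distance 1 contribute t sum_y (f y - f x)^2 plus twice the subtracted terms of
adjacent pairs, and the walks that reach distance 2 absorb the subtracted terms
of nonadjacent pairs, which the squares above match with them.  Hence
Gamma2 >= (4 + t)/(2D) Gamma.  The function with values 0, 1, 2 at x, on its
neighbours and elsewhere attains equality, and (4 + t)/(2D) = 1/D + 1/L.
Finally D t is twice the number of triangles at x. *)

(** * The combinatorial distance *)

Section Distance.
Variables (V : finType) (e : rel V).
Hypothesis e_graph : connected_graph e.

Lemma edge_sym x y : e x y = e y x.
Proof. by case: e_graph. Qed.

Lemma edge_irr x : e x x = false.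
Proof. by case: e_graph. Qed.

Lemma gdist_path x y :
  exists p, [/\ path e x p, last x p = y & size p = gdist e x y].
Proof.
have [_ _ ec _] := e_graph.
have /existsP [p /andP [ep /eqP lp]] := gdist_walk (ec x y).
by exists p; rewrite size_tuple.
Qed.

Lemma gdist_refl x : gdist e x x = 0%N.
Proof. by apply/eqP; rewrite -leqn0 (@gdist_min _ _ _ _ [::]). Qed.

Lemma gdist_eq0 x y : gdist e x y = 0%N -> x = y.
Proof.
move=> d0; have [p [_ lp]] := gdist_path x y.
by rewrite d0 => /size0nil p0; rewrite -lp p0.
Qed.

Lemma gdist_triangle x y z : (gdist e x z <= gdist e x y + gdist e y z)%N.
Proof.
have [p [ep lp <-]] := gdist_path x y; have [q [eq lq <-]] := gdist_path y z.
rewrite -size_cat; apply: gdist_min; first by rewrite cat_path ep lp.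
by rewrite last_cat lp.
Qed.

Lemma gdist_edge_le1 x y : e x y -> (gdist e x y <= 1)%N.
Proof. by move=> exy; apply: (@gdist_min _ _ _ _ [:: y]); rewrite //= exy. Qed.

Lemma gdist_sym x y : gdist e x y = gdist e y x.
Proof.
suff le u v : (gdist e u v <= gdist e v u)%N by apply/eqP; rewrite eqn_leq !le.
have [p [ep lp <-]] := gdist_path v u.
rewrite -(size_belast v p) -size_rev; apply: gdist_min.
  rewrite -lp rev_path; under eq_path => a b do rewrite edge_sym.
  exact: ep.
by case: p lp {ep} => //= a p _; rewrite rev_cons last_rcons.
Qed.

Lemma gdist_step x u v : e u v -> (gdist e x v <= (gdist e x u).+1)%N.
Proof.
by move=> /gdist_edge_le1 duv; have := gdist_triangle x u v; lia.
Qed.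

Lemma gdist_edge x y : (gdist e x y == 1%N) = e x y.
Proof.
apply/idP/idP => [/eqP d1|exy].
  have [[|a [|b p]] [//= ep lp]] := gdist_path x y; rewrite d1 //= => _.
  by move: ep; rewrite -lp /= andbT.
have := gdist_edge_le1 exy; case E: (gdist e x y) => [|[|//]] // _.
by move: exy; rewrite (gdist_eq0 E) edge_irr.
Qed.

Lemma gdist_gt1 x y : (1 < gdist e x y)%N = (x != y) && ~~ e x y.
Proof.
rewrite -gdist_edge; case: eqVneq => [->|ne]; first by rewrite gdist_refl.
by case E: (gdist e x y) ne => [|[|n]] //; rewrite (gdist_eq0 E) eqxx.
Qed.

Lemma gdist_le_diam x y : (gdist e x y <= diam e)%N.
Proof. by apply: leq_trans (leq_bigmax x); apply: leq_bigmax. Qed.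

Lemma diam_gt0 : (0 < diam e)%N.
Proof.
have [_ _ _ [x [y exy]]] := e_graph.
by apply: leq_trans (gdist_le_diam x y); move: exy; rewrite -gdist_edge => /eqP->.
Qed.

(** Along an edge in both directions, since adjacency is symmetric; natural
values suffice because all test functions are built from distances. *)
Definition lipschitz1 (g : V -> nat) := forall u v, e u v -> (g v <= (g u).+1)%N.

Lemma lipschitz1_gdist x : lipschitz1 (gdist e x).
Proof. by move=> u v; apply: gdist_step. Qed.

Lemma lipschitz1_cone k x : lipschitz1 (fun u => k - gdist e x u)%N.
Proof.
by move=> u v euv; have := @gdist_step x v u; rewrite edge_sym => /(_ euv); lia.
Qed.

Lemma lipschitz1_min g h :
  lipschitz1 g -> lipschitz1 h -> lipschitz1 (fun u => minn (g u) (h u)).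
Proof. by move=> gl hl u v euv; have := gl _ _ euv; have := hl _ _ euv; lia. Qed.

Lemma lipschitz1_max g h :
  lipschitz1 g -> lipschitz1 h -> lipschitz1 (fun u => maxn (g u) (h u)).
Proof. by move=> gl hl u v euv; have := gl _ _ euv; have := hl _ _ euv; lia. Qed.

Lemma lipschitz1_le g u v : lipschitz1 g -> (g v <= g u + gdist e u v)%N.
Proof.
move=> gl; have [p [ep <- <-]] := gdist_path u v.
elim: p u ep => [|a p IH] u /=; first by rewrite addn0.
by move=> /andP [/gl ga /IH]; lia.
Qed.

End Distance.

(** * Curvature bounds tested on Lipschitz functions *)

Section Transport.
Variables (V : finType) (e : rel V) (R : realType) (D L : nat).
Hypothesis e_graph : connected_graph e.
Hypothesis e_sharp : Bonnet_Myers_sharp e R D L.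

Definition ball (x : V) : pred V := fun u => (u == x) || e x u.

Definition ball_sum (g : V -> nat) (x : V) : R := \sum_(u | ball x u) (g u)%:R.

Lemma ball_sumE (g : V -> nat) x :
  ball_sum g x = (g x)%:R + \sum_(u | e x u) (g u)%:R.
Proof.
rewrite /ball_sum (bigD1 x) /=; last by rewrite /ball eqxx.
congr (_ + _); apply: eq_bigl => u; rewrite /ball.
by case: eqVneq => [->|]; rewrite /= ?(edge_irr e_graph) ?andbT.
Qed.

Lemma degreeE x : \sum_(u | e x u) 1 = D%:R :> R.
Proof.
have [reg _ _] := e_sharp; rewrite -(reg x) sumr_const.
by congr (_ *+ _); apply: eq_card => u; rewrite !inE.
Qed.

Lemma D_gt0 : (0 < D)%N.
Proof.
have [reg _ _] := e_sharp; have [_ _ _ [x [y exy]]] := e_graph.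
by rewrite -(reg x); apply/card_gt0P; exists y; rewrite inE.
Qed.

Lemma L_gt0 : (0 < L)%N.
Proof. by have [_ <- _] := e_sharp; exact: diam_gt0. Qed.

Lemma lazy_measure_sum (g : V -> nat) x :
  \sum_u (g u)%:R * lazy_measure e R D x u = D.+1%:R^-1 * ball_sum g x.
Proof.
rewrite /ball_sum mulr_sumr [RHS]big_mkcond /=; apply: eq_bigr => u _.
by rewrite /lazy_measure /ball; case: ifP => _; rewrite ?mulr0 // mulrC.
Qed.

Lemma lazy_measure_mass x : \sum_u lazy_measure e R D x u = 1.
Proof.
have := lazy_measure_sum (fun=> 1%N) x.
rewrite ball_sumE degreeE (_ : 1%:R = 1 :> R) // nat1r mulVf ?pnatr_eq0 //.
by under eq_bigr do rewrite mul1r.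
Qed.

Lemma lazy_measure_bounds x u : 0 <= lazy_measure e R D x u <= 1.
Proof.
rewrite /lazy_measure; case: ifP => _; rewrite ?lexx ?ler01 // invr_ge0 ler0n /=.
by rewrite invf_le1 ?ltr0n // ler1n.
Qed.

(** Weak Kantorovich duality: transporting mass from u to v costs at least
[g v - g u], whatever the coupling. *)
Lemma lipschitz_le_W1 (g : V -> nat) x y : lipschitz1 e g ->
  D.+1%:R^-1 * (ball_sum g y - ball_sum g x)
  <= W1 e (lazy_measure e R D x) (lazy_measure e R D y).
Proof.
move=> gl; apply: lb_le_inf.
  exists (transport_cost e
    (fun u v => lazy_measure e R D x u * lazy_measure e R D y v)).
  exists (fun u v => lazy_measure e R D x u * lazy_measure e R D y v) => //.
  split=> [u v|u|v].
  - have /andP [a0 a1] := lazy_measure_bounds x u.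
    have /andP [b0 b1] := lazy_measure_bounds y v.
    by rewrite mulr_ge0 // mulr_ile1.
  - by rewrite -mulr_sumr lazy_measure_mass mulr1.
  - by rewrite -mulr_suml lazy_measure_mass mul1r.
move=> _ [p [p01 pu pv] <-].
rewrite mulrBr -!lazy_measure_sum /transport_cost.
rewrite (eq_bigr (fun v => \sum_u (g v)%:R * p u v)); last first.
  by move=> v _; rewrite -mulr_sumr pv.
rewrite [X in _ - X](eq_bigr (fun u => \sum_v (g u)%:R * p u v)); last first.
  by move=> u _; rewrite -mulr_sumr pu.
rewrite exchange_big -sumrB; apply: ler_sum => u _.
rewrite -sumrB; apply: ler_sum => v _; rewrite -mulrBl ler_wpM2r //.
  by have /andP [] := p01 u v.
by rewrite lerBlDr -natrD ler_nat addnC; apply: lipschitz1_le.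
Qed.

(** The edge curvature bound [2 / L] amounts to
[(D + 1) W1 <= D + 1 - 2 D / L], the right-hand side being this constant. *)
Definition sharp_increment : R := D.+1%:R - 2 * D%:R / L%:R.

(** An infimum over a set unbounded below would be [0], which the positive
value [2 / L] excludes; so the infimum is a lower bound. *)
Lemma kappa_ge x y : e x y -> 2 / L%:R <= kappa e R D x y.
Proof.
move=> exy; have [_ _ infE] := e_sharp.
have L0 : 0 < 2 / L%:R :> R by rewrite divr_gt0 // ltr0n L_gt0.
set E := (X in inf X = _) in infE.
have [[_ Elb]|/inf_out E0] := pselect (has_inf E).
  by rewrite -infE; apply: ge_inf => //; exists x, y.
by move: L0; rewrite -infE E0 ltxx.
Qed.

Lemma ball_sum_edge_le (g : V -> nat) x y : lipschitz1 e g -> e x y ->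
  ball_sum g y - ball_sum g x <= sharp_increment.
Proof.
move=> gl exy; have := kappa_ge exy; have := lipschitz_le_W1 x y gl.
have -> : kappa e R D x y = D.+1%:R / D%:R
    * (1 - W1 e (lazy_measure e R D x) (lazy_measure e R D y)).
  by move: (exy); rewrite -(gdist_edge e_graph) /kappa => /eqP ->; rewrite divr1.
move: (W1 _ _ _) => w.
have D0 : 0 < D%:R :> R by rewrite ltr0n D_gt0.
have D1 : 0 < D.+1%:R :> R by rewrite ltr0n.
rewrite ler_pdivrMl // => gw; rewrite mulrAC ler_pdivlMr // => kw.
by rewrite /sharp_increment (mulrAC 2 D%:R); lra.
Qed.

Lemma ball_sum_le (g : V -> nat) x y : lipschitz1 e g ->
  ball_sum g y - ball_sum g x <= (gdist e x y)%:R * sharp_increment.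
Proof.
move=> gl; have [p [ep <- <-]] := gdist_path e_graph x y.
elim: p x ep => [|a p IH] x /=; first by rewrite subrr mul0r.
move=> /andP [exa /IH pa]; have := ball_sum_edge_le gl exa.
by rewrite -[(size p).+1]addn1 natrD; lra.
Qed.

End Transport.

(** * Geometry of self-centered sharp graphs *)

Section Structure.
Variables (V : finType) (e : rel V) (R : realType) (D L : nat).
Hypothesis e_graph : connected_graph e.
Hypothesis e_sharp : Bonnet_Myers_sharp e R D L.

Local Notation d := (gdist e).
Local Notation S := (ball_sum e R).
Local Notation c := (sharp_increment R D L).

Lemma L_sharp_increment : L%:R * c = D.+1%:R * L%:R - 2 * D%:R.
Proof.
have : L%:R != 0 :> R by rewrite pnatr_eq0 -lt0n (L_gt0 e_graph e_sharp).
by rewrite /sharp_increment => L0; field.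
Qed.

Lemma ball_sum_gdist_center x : S (d x) x = D%:R.
Proof.
rewrite (ball_sumE _ e_graph) gdist_refl add0r -(degreeE e_sharp x).
by apply: eq_bigr => u; rewrite -(gdist_edge e_graph) => /eqP ->.
Qed.

Lemma ball_sum_gdist_antipode_ge x xb : d x xb = L ->
  L%:R + D%:R * (L%:R - 1) <= S (d x) xb.
Proof.
move=> dL; rewrite (ball_sumE _ e_graph) dL lerD2l.
rewrite -(degreeE e_sharp xb) mulr_suml; apply: ler_sum => u eu.
rewrite mul1r lerBlDr natr1 ler_nat -dL; apply: gdist_step => //.
by rewrite edge_sym.
Qed.

(** Between the poles [x] and [xb] the ball sum of [gdist e x] grows by at
least [L c], while each half of a geodesic through [y] lets it grow by at most
[c] per step: both halves are extremal. *)
Lemma ball_sum_gdist_interval x xb y : d x xb = L -> (d x y + d y xb)%N = L ->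
  S (d x) y = D%:R + (d x y)%:R * c.
Proof.
move=> dL dy; have gl := lipschitz1_gdist e_graph x.
have := ball_sum_le e_graph e_sharp x y gl.
have := ball_sum_le e_graph e_sharp y xb gl.
have := ball_sum_gdist_antipode_ge dL; rewrite ball_sum_gdist_center.
have := L_sharp_increment; rewrite -{1}dy natrD -[D.+1%:R]natr1.
by move=> *; lra.
Qed.

(** At a vertex [u] of the interval, the ball sum of [d x w + d xb w] is the
least possible value [(D + 1) L]; each term being at least [L], all neighbours
of [u] belong to the interval too, and connectedness concludes. *)
Lemma antipodal_interval x xb y : d x xb = L -> (d x y + d y xb)%N = L.
Proof.
move=> dL; have dL' : d xb x = L by rewrite (gdist_sym e_graph).
have step u v : e u v -> (d x u + d u xb)%N = L -> (d x v + d v xb)%N = L.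
  move=> euv du; have du' : (d xb u + d u x)%N = L.
    by rewrite addnC (gdist_sym e_graph u x) (gdist_sym e_graph xb u).
  have dx := ball_sum_gdist_interval dL du.
  have dxb := ball_sum_gdist_interval dL' du'.
  have tri w : 0 <= (d x w)%:R + (d xb w)%:R - L%:R :> R.
    rewrite subr_ge0 -natrD ler_nat (gdist_sym e_graph xb) -dL.
    exact: gdist_triangle.
  have : \sum_(w | ball e u w) ((d x w)%:R + (d xb w)%:R - L%:R) = 0 :> R.
    rewrite sumrB big_split /= -/(S (d x) u) -/(S (d xb) u) dx dxb.
    have -> : \sum_(w | ball e u w) L%:R = D.+1%:R * L%:R :> R.
      have := ball_sumE R e_graph (fun=> L) u; rewrite /ball_sum => ->.
      rewrite (eq_bigr (fun=> 1 * L%:R)); last by move=> *; rewrite mul1r.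
      by rewrite -mulr_suml (degreeE e_sharp) -[D.+1%:R]nat1r mulrDl mul1r.
    have := L_sharp_increment; rewrite -{1}du natrD.
    by rewrite (gdist_sym e_graph xb u); lra.
  move=> /psumr_eq0P h0; have vu : ball e u v by rewrite /ball euv orbT.
  have /eqP := h0 (fun w _ => tri w) v vu.
  rewrite subr_eq0 -natrD eqr_nat => /eqP.
  by rewrite (gdist_sym e_graph xb).
have along p z : path e z p -> (d x z + d z xb)%N = L ->
    (d x (last z p) + d (last z p) xb)%N = L.
  elim: p z => //= a p IH z /andP [eza pa] dz; apply: IH => //.
  exact: step eza dz.
have [p [ep <- _]] := gdist_path e_graph x y.
by apply: along => //; rewrite gdist_refl.
Qed.

Hypothesis e_self_centered : self_centered e.

(** Equivalently, [d x - L / 2] is an eigenfunction of the Laplacian for the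
eigenvalue [- 2 / L]. *)
Lemma ball_sum_gdist x y : S (d x) y = D%:R + (d x y)%:R * c.
Proof.
have [xb] := e_self_centered x; have [_ -> _] := e_sharp => dL.
by apply: (ball_sum_gdist_interval dL); apply: antipodal_interval.
Qed.

Lemma ball_sumD (g h : V -> nat) x :
  S (fun u => g u + h u)%N x = S g x + S h x.
Proof. by rewrite /ball_sum -big_split; apply: eq_bigr => u _; rewrite natrD. Qed.

Lemma ball_sumB (h : V -> nat) x y : S h y - S h x =
  \sum_(b | ball e y b && ~~ ball e x b) (h b)%:R
  - \sum_(a | ball e x a && ~~ ball e y a) (h a)%:R.
Proof.
rewrite /ball_sum (bigID (ball e x)) /= [X in _ - X](bigID (ball e y)) /=.
rewrite [X in _ - (X + _)](eq_bigl _ _ (fun u => andbC _ _)).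
by move: (\sum_(_ | _ && _) _) => s; lra.
Qed.

(** The ball sum of [d x] at [y] counts the neighbours of [y] by their distance
to [x], which is 0 at [x], 1 at a common neighbour and 2 elsewhere. *)
Lemma common_neighbours x y : e x y ->
  \sum_(u | e x u && e y u) 1 = 2 * D%:R / L%:R - 2 :> R.
Proof.
move=> exy; have eyx : e y x by rewrite edge_sym.
have dxu u : e y u -> (d x u + e x u + 2 * (u == x) = 2)%N.
  move=> eyu; have [->|ne] := eqVneq u x; first by rewrite gdist_refl edge_irr.
  have := gdist_step e_graph x eyu; move: (exy).
  rewrite -!(gdist_edge e_graph) => /eqP ->.
  case E: (d x u) => [|[|[|n]]] //= _.
  by rewrite (gdist_eq0 e_graph E) eqxx in ne.
have sumx : \sum_(u | e y u) (2 * (u == x))%:R = 2 :> R.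
  rewrite (bigD1 x) //= eqxx muln1 [X in _ + X]big1 ?addr0 //.
  by move=> u /andP [_ /negbTE ->]; rewrite muln0.
have sumxy : \sum_(u | e y u) (e x u)%:R = \sum_(u | e x u && e y u) 1 :> R.
  under [RHS]eq_bigl do rewrite andbC.
  by rewrite big_mkcondr; apply: eq_bigr => u _; case: (e x u).
have : \sum_(u | e y u) (d x u + e x u + 2 * (u == x))%:R
  = \sum_(u | e y u) 1 * 2 :> R.
  by apply: eq_bigr => u /dxu ->; rewrite mul1r.
rewrite -mulr_suml (degreeE e_sharp).
under eq_bigr do rewrite natrD (natrD _ (d x _)).
rewrite !big_split /= sumx sumxy.
have := ball_sum_gdist x y; rewrite (ball_sumE _ e_graph).
move: (exy); rewrite -(gdist_edge e_graph) => /eqP ->.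
by rewrite /sharp_increment -[D.+1%:R]natr1; lra.
Qed.

Lemma ball_sum_gdist_increment z x y : d z y = (d z x).+1 ->
  S (d z) y - S (d z) x = c.
Proof. by move=> dz; rewrite !ball_sum_gdist dz -[(d z x).+1%:R]natr1; lra. Qed.

(** If no such [b] existed, every neighbour of [y] at distance 2 from [x] would
also be at distance at least 2 from [a].  Then replacing [d x] by the minimum of
[d x] and [d a] would lower the ball sum at [x], because of [a], but not the
one at [y], contradicting the extremality of [d x] across the edge. *)
Lemma edge_square_exists x y a : e x y -> e x a -> ~~ ball e y a ->
  exists b, [/\ e y b, ~~ ball e x b & e a b].
Proof.
move=> exy exa yNa; have eyx : e y x by rewrite edge_sym.
have [b /and3P [eyb xNb eab]|noB] :=
  pickP (fun b => [&& e y b, ~~ ball e x b & e a b]).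
  by exists b.
pose g u := minn (d x u) (d a u); pose h u := (d x u - d a u)%N.
have gl : lipschitz1 e g.
  by apply: lipschitz1_min; apply: lipschitz1_gdist.
have dxE : d x = fun u => (g u + h u)%N.
  by apply: funext => u; rewrite /g /h; lia.
have inc : S (d x) y - S (d x) x = c.
  apply: ball_sum_gdist_increment; rewrite gdist_refl.
  by apply/eqP; rewrite gdist_edge.
have := ball_sum_edge_le e_graph e_sharp gl exy.
move: inc; rewrite dxE !ball_sumD => inc gle.
have : 0 <= S h y - S h x by lra.
rewrite ball_sumB [X in X - _]big1; last first.
  move=> b /andP [yb xNb]; suff : (d x b <= d a b)%N by rewrite /h => /eqP ->.
  have eyb : e y b.
    by move: yb xNb; rewrite /ball; case/orP => [/eqP ->|//]; rewrite exy orbT.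
  have : (1 < d a b)%N.
    rewrite gdist_gt1 //; have := noB b; rewrite eyb xNb /= => ->.
    by rewrite andbT; apply: contraNneq xNb => <-; rewrite /ball exa orbT.
  have := gdist_step e_graph x eyb; move: (exy).
  by rewrite -(gdist_edge e_graph) => /eqP ->; lia.
rewrite sub0r oppr_ge0 (bigD1 a) /=; last by rewrite /ball exa orbT.
rewrite /h gdist_refl subn0; move: (exa); rewrite -(gdist_edge e_graph) => /eqP ->.
by rewrite leNgt ltr_wpDr ?ltr01 ?sumr_ge0.
Qed.

(** With two such vertices [b1] and [b2], raise [d a] to the least Lipschitz
function above it with value at least 2 at both.  In the part of the ball of [y]
outside that of [x] the gain is at least 2, whereas in the part of the ball of
[x] outside that of [y] the only gain is 1, at [a].  This contradicts the
extremality of [d a] across the edge. *)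
Lemma edge_square_unique x y a b1 b2 : e x y -> e x a -> ~~ ball e y a ->
  e y b1 -> ~~ ball e x b1 -> e a b1 ->
  e y b2 -> ~~ ball e x b2 -> e a b2 -> b1 = b2.
Proof.
move=> exy exa yNa eyb1 xNb1 eab1 eyb2 xNb2 eab2.
apply/eqP/negPn/negP => ne.
have dax : d a x = 1%N by apply/eqP; rewrite gdist_edge // edge_sym.
have day : d a y = 2%N.
  have := gdist_step e_graph a exy; rewrite dax => day.
  apply/eqP; rewrite eqn_leq day.
  by rewrite gdist_gt1 // (edge_sym e_graph a) -negb_or.
pose g u := maxn (d a u) (maxn (2 - d b1 u) (2 - d b2 u)).
pose h u := (g u - d a u)%N.
have gl : lipschitz1 e g.
  apply: lipschitz1_max; first exact: lipschitz1_gdist.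
  by apply: lipschitz1_max; apply: lipschitz1_cone.
have gE : g = fun u => (d a u + h u)%N.
  by apply: funext => u; rewrite /h subnKC // leq_maxl.
have d_pos b u : ball e x u -> ~~ ball e x b -> (0 < d b u)%N.
  by move=> xu; apply: contraNltn; rewrite leqn0 => /eqP /(gdist_eq0 e_graph) ->.
have hb b : e a b -> (2 - d b b <= g b)%N -> (0 < h b)%N.
  by rewrite -(gdist_edge e_graph) gdist_refl subn_gt0 => /eqP ->.
have hb1 : (0 < h b1)%N by apply: hb; rewrite // /g !leq_max leqnn !orbT.
have hb2 : (0 < h b2)%N by apply: hb; rewrite // /g !leq_max leqnn !orbT.
have xa : ball e x a by rewrite /ball exa orbT.
have ha : (h a <= 1)%N.
  by rewrite /h /g gdist_refl max0n subn0 geq_max !leq_subLR !addn1 !ltnS !d_pos.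
have hA u : ball e x u && ~~ ball e y u && (u != a) -> h u = 0%N.
  move=> /andP [/andP [xu _] ua]; apply/eqP; rewrite /h /g subn_eq0 !geq_max leqnn.
  have dau : (0 < d a u)%N.
    by rewrite lt0n; apply: contraNneq ua => /(gdist_eq0 e_graph) ->.
  by rewrite !(leq_trans _ dau) ?leq_subLR ?addn1 ?ltnS ?d_pos.
have inc : S (d a) y - S (d a) x = c.
  by apply: ball_sum_gdist_increment; rewrite dax.
have := ball_sum_edge_le e_graph e_sharp gl exy.
rewrite gE !ball_sumD => gle.
have : S h y - S h x <= 0 by lra.
rewrite ball_sumB (bigD1 b1) /=; last by rewrite {1}/ball eyb1 orbT.
rewrite (bigD1 b2) /=; last by rewrite {1}/ball eyb2 orbT xNb2 eq_sym.
rewrite [X in _ - X](bigD1 a) /= ?xa // [X in _ - (_ + X)]big1 => [|u /hA -> //].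
rewrite addr0 subr_le0 addrA leNgt => /negP; apply.
apply: ltr_wpDr; first by apply: sumr_ge0.
by rewrite -natrD ltr_nat; apply: leq_ltn_trans ha (leq_add hb1 hb2).
Qed.

End Structure.

(** * Finite sums *)

Section Sums.
Variables (I : finType) (R : realType).

Lemma sum_swap_sym (A : pred I) (r : rel I) (F : I -> I -> R) : symmetric r ->
  \sum_(y | A y) \sum_(z | A z && r y z) F y z
  = \sum_(y | A y) \sum_(z | A z && r y z) F z y.
Proof.
move=> rs; rewrite (exchange_big_dep A) /=; last by move=> ? ? _ /andP [].
by apply: eq_bigr => z Az; apply: eq_bigl => y; rewrite Az rs.
Qed.

Lemma sum_unique_le (P : pred I) (w : R) : 0 <= w ->
  (forall i j, P i -> P j -> i = j) -> \sum_(i | P i) w <= w.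
Proof.
move=> w0 Puniq; have [i Pi|P0] := pickP P; last by rewrite big_pred0.
rewrite (bigD1 i) //= big1 ?addr0 // => j /andP [Pj].
by rewrite (Puniq _ _ Pj Pi) eqxx.
Qed.

Lemma sum_sqr_diff (A : pred I) (a : I -> R) :
  \sum_(y | A y) \sum_(z | A z) (a y - a z) ^+ 2
  = 2 * (\sum_(y | A y) 1) * (\sum_(y | A y) a y ^+ 2)
    - 2 * (\sum_(y | A y) a y) ^+ 2.
Proof.
set Q := \sum_(y | A y) a y ^+ 2; set M := \sum_(y | A y) a y.
set n := \sum_(y | A y) 1.
have inner y : \sum_(z | A z) (a y - a z) ^+ 2
    = (a y ^+ 2 * n + Q) - 2 * (a y * M).
  rewrite /n /Q /M !mulr_sumr -big_split -sumrB /=.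
  by apply: eq_bigr => z _; ring.
rewrite (eq_bigr _ (fun y _ => inner y)) sumrB big_split /= -mulr_suml -/Q.
rewrite -mulr_sumr -mulr_suml -/M.
have -> : \sum_(y | A y) Q = n * Q.
  by rewrite mulr_suml; under [RHS]eq_bigr do rewrite mul1r.
ring.
Qed.

End Sums.

(** * The iterated carre du champ as a sum of squares *)

Section BakryEmery.
Variables (V : finType) (e : rel V) (R : realType) (D : nat).
Hypothesis D_neq0 : D%:R != 0 :> R.
Hypothesis degree : forall x, \sum_(u | e x u) 1 = D%:R :> R.

Lemma GammaE (f g : V -> R) x : Gamma e D f g x
  = (2 * D%:R)^-1 * \sum_(y | e x y) (f y - f x) * (g y - g x).
Proof.
have -> : \sum_(y | e x y) (f y - f x) * (g y - g x)
  = \sum_(y | e x y) (f y * g y - f x * g x)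
    - f x * \sum_(y | e x y) (g y - g x) - g x * \sum_(y | e x y) (f y - f x).
  by rewrite !mulr_sumr -!sumrB; apply: eq_bigr => y _; ring.
by rewrite /Gamma /laplacian; field.
Qed.

Definition sqr_second_diff (f : V -> R) x y z : R := (f z - 2 * f y + f x) ^+ 2.

(** Completing the square [(f z - f y)^2 - 2 (f y - f x) (f z - f y)] in the
expansion of [Gamma2] produces the second differences; the remaining quadratic
form in the values [f y - f x] is the one of [sum_sqr_diff]. *)
Lemma Gamma2E (f : V -> R) x : Gamma2 e D f f x = (4 * D%:R ^+ 2)^-1 *
  (\sum_(y | e x y) \sum_(z | e y z) sqr_second_diff f x y z
   - \sum_(y | e x y) \sum_(z | e x z) (f y - f z) ^+ 2).
Proof.
set Q := \sum_(y | e x y) (f y - f x) ^+ 2.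
set M := \sum_(y | e x y) (f y - f x).
pose P y := \sum_(z | e y z) (f z - f y) ^+ 2.
pose B y := \sum_(z | e y z) (f z - f y).
have sdE y : \sum_(z | e y z) sqr_second_diff f x y z
    = P y - 2 * ((f y - f x) * B y) + D%:R * (f y - f x) ^+ 2.
  rewrite -(degree y) /P /B !mulr_sumr mulr_suml -sumrB -big_split /=.
  by apply: eq_bigr => z _; rewrite /sqr_second_diff; ring.
have diffE : \sum_(y | e x y) \sum_(z | e x z) (f y - f z) ^+ 2
    = 2 * D%:R * Q - 2 * M ^+ 2.
  rewrite -(degree x) -sum_sqr_diff; apply: eq_bigr => y _.
  by apply: eq_bigr => z _; congr (_ ^+ 2); ring.
have DG : D%:R * laplacian e D (Gamma e D f f) x
    = (2 * D%:R)^-1 * (\sum_(y | e x y) P y - D%:R * Q).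
  have -> : D%:R * Q = \sum_(y | e x y) Q.
    by rewrite -(degree x) mulr_suml; apply: eq_bigr => y _; rewrite mul1r.
  rewrite /laplacian mulVKf // -sumrB mulr_sumr.
  apply: eq_bigr => y _; rewrite !GammaE mulrBr /P /Q.
  by congr (_ * _ - _ * _); apply: eq_bigr => z _; rewrite expr2.
have GD : Gamma e D f (laplacian e D f) x = (2 * D%:R ^+ 2)^-1 *
    (\sum_(y | e x y) (f y - f x) * B y - M ^+ 2).
  have -> : M ^+ 2 = \sum_(y | e x y) (f y - f x) * M.
    by rewrite expr2 {1}/M mulr_suml.
  rewrite GammaE -sumrB !mulr_sumr.
  by apply: eq_bigr => y _; rewrite /laplacian -/M -/(B y); field.
have GC : Gamma e D (laplacian e D f) f x = Gamma e D f (laplacian e D f) x.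
  by rewrite !GammaE; congr (_ * _); apply: eq_bigr => y _; rewrite mulrC.
rewrite /Gamma2 GC GD diffE (eq_bigr _ (fun y _ => sdE y)) big_split sumrB /=.
rewrite -!mulr_sumr -/Q; have -> : laplacian e D (Gamma e D f f) x
    = D%:R^-1 * ((2 * D%:R)^-1 * (\sum_(y | e x y) P y - D%:R * Q)).
  by rewrite -DG mulKf.
by field.
Qed.

End BakryEmery.

(** * Curvature from the local geometry *)

Section LocalStructure.
Variables (V : finType) (e : rel V) (R : realType) (D : nat) (t : R).
Hypothesis es : symmetric e.
Hypothesis ei : irreflexive e.
Hypothesis D_neq0 : D%:R != 0 :> R.
Hypothesis degree : forall x, \sum_(u | e x u) 1 = D%:R :> R.
Hypothesis common : forall x y, e x y -> \sum_(u | e x u && e y u) 1 = t.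

Local Notation sd := sqr_second_diff.

Lemma neighbour_split (F : V -> R) x y : e x y ->
  \sum_(u | e y u) F u = F x + \sum_(u | e x u && e y u) F u
    + \sum_(u | e y u && ~~ ball e x u) F u.
Proof.
move=> exy; rewrite (bigD1 x) /=; last by rewrite es.
rewrite (bigID (e x)) /= addrA; congr (_ + _ + _); apply: eq_bigl => u.
  by case: eqVneq => [->|_]; rewrite /= ?ei ?andbF // andbT andbC.
by rewrite /ball negb_or andbA.
Qed.

Section LowerBound.
Hypothesis square_exists : forall x y a, e x y -> e x a -> ~~ ball e y a ->
  exists b, [/\ e y b, ~~ ball e x b & e a b].
Hypothesis square_unique : forall x y a b1 b2,
  e x y -> e x a -> ~~ ball e y a ->
  e y b1 -> ~~ ball e x b1 -> e a b1 ->
  e y b2 -> ~~ ball e x b2 -> e a b2 -> b1 = b2.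

(** Put [a = f y - f x] and [b = f z - f x]; then
[(b - 2 a)^2 = 2 (a - b)^2 + 2 a^2 - b^2], and exchanging [y] and [z] turns the
sum of [b^2] into that of [a^2]. *)
Lemma adjacent_terms (f : V -> R) x :
  \sum_(y | e x y) \sum_(z | e x z && e y z) sd f x y z
  = 2 * (\sum_(y | e x y) \sum_(z | e x z && e y z) (f y - f z) ^+ 2)
    + t * \sum_(y | e x y) (f y - f x) ^+ 2.
Proof.
have tE : t * \sum_(y | e x y) (f y - f x) ^+ 2
    = \sum_(y | e x y) \sum_(z | e x z && e y z) (f y - f x) ^+ 2.
  rewrite mulr_sumr; apply: eq_bigr => y exy.
  by rewrite -(common exy) mulr_suml; under eq_bigr do rewrite mul1r.
have tE' := tE; rewrite (sum_swap_sym _ _ es) in tE'.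
have -> : t * \sum_(y | e x y) (f y - f x) ^+ 2
    = 2 * (t * \sum_(y | e x y) (f y - f x) ^+ 2)
      - t * \sum_(y | e x y) (f y - f x) ^+ 2 by ring.
rewrite {1}tE tE' !mulr_sumr -sumrB -big_split /=; apply: eq_bigr => y _.
rewrite !mulr_sumr -sumrB -big_split /=; apply: eq_bigr => z _.
by rewrite /sqr_second_diff; ring.
Qed.

Lemma ball_sym x y : ball e x y = ball e y x.
Proof. by rewrite /ball es eq_sym. Qed.

(** A nonadjacent pair [y], [z] of neighbours of [x] is closed to a square by a
unique [b], and [(f y - f z)^2] is at most the mean of the squared second
differences along the walks [x, y, b] and [x, z, b].  Conversely a walk
[x, y, b] comes from a single pair, since [z] is unique given [y] and [b]; so
no walk is used twice. *)
Lemma nonadjacent_terms (f : V -> R) x :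
  \sum_(y | e x y) \sum_(z | e x z && ~~ ball e y z) (f y - f z) ^+ 2
  <= \sum_(y | e x y) \sum_(z | e y z && ~~ ball e x z) sd f x y z.
Proof.
pose corner y z b := [&& e y b, ~~ ball e x b & e z b].
pose W F := \sum_(y | e x y) \sum_(z | e x z && ~~ ball e y z)
  \sum_(b | corner y z b) F y z b : R.
have sd_ge0 y b : 0 <= sd f x y b by apply: sqr_ge0.
apply: (@le_trans _ _ (W (fun y z _ => (f y - f z) ^+ 2))).
  apply: ler_sum => y exy; apply: ler_sum => z /andP [exz yNz].
  have [b [eyb xNb ezb]] := square_exists exy exz yNz.
  rewrite (bigD1 b) /=; last by rewrite /corner eyb xNb.
  by rewrite lerDl sumr_ge0 // => *; apply: sqr_ge0.
apply: (@le_trans _ _ (W (fun y _ b => sd f x y b))).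
  have swap : W (fun y _ b => sd f x y b) = W (fun _ z b => sd f x z b).
    rewrite /W (@sum_swap_sym _ _ _ (fun y z => ~~ ball e y z)) /=.
      do 2 (apply: eq_bigr => ? _); apply: eq_bigl => b.
      by rewrite /corner andbCA andbC -andbA [RHS]andbCA; do 3 case: (_ b).
    by move=> y z; rewrite ball_sym.
  have -> : W (fun y _ b => sd f x y b)
      = (W (fun y _ b => sd f x y b) + W (fun _ z b => sd f x z b)) / 2.
    by rewrite -swap; field.
  (* The two second differences differ by [2 (f z - f y)]. *)
  rewrite ler_pdivlMr // mulr_suml -big_split; apply: ler_sum => y _ /=.
  rewrite mulr_suml -big_split; apply: ler_sum => z _ /=.
  rewrite mulr_suml -big_split; apply: ler_sum => b _ /=.
  have := sqr_ge0 (f b - f y + (f x - f z)); rewrite /sqr_second_diff; nra.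
(* From here on, a walk [x, y, b] determines the third corner [z]. *)
apply: ler_sum => y exy.
rewrite (exchange_big_dep (fun b => e y b && ~~ ball e x b)) /=; last first.
  by move=> z b _ /and3P [-> ->].
apply: ler_sum => b /andP [eyb xNb]; apply: sum_unique_le => // z1 z2.
move=> /andP [/andP [exz1 yNz1] /and3P [_ _ ezb1]].
move=> /andP [/andP [exz2 yNz2] /and3P [_ _ ezb2]].
by apply: (@square_unique y x b); rewrite // es.
Qed.

Lemma Gamma2_ge (f : V -> R) x :
  (4 + t) / (2 * D%:R) * Gamma e D f f x <= Gamma2 e D f f x.
Proof.
rewrite (Gamma2E D_neq0 degree) GammaE //.
set Q := \sum_(y | e x y) (f y - f x) * (f y - f x).
have QE : Q = \sum_(y | e x y) (f y - f x) ^+ 2.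
  by apply: eq_bigr => y _; rewrite expr2.
have -> : (4 + t) / (2 * D%:R) * ((2 * D%:R)^-1 * Q)
  = (4 * D%:R ^+ 2)^-1 * ((4 + t) * Q) by field.
apply: ler_wpM2l; first by rewrite invr_ge0 mulr_ge0 ?sqr_ge0.
have -> : \sum_(y | e x y) \sum_(z | e y z) sd f x y z
  = 4 * Q + (2 * (\sum_(y | e x y) \sum_(z | e x z && e y z) (f y - f z) ^+ 2)
     + t * Q)
    + \sum_(y | e x y) \sum_(z | e y z && ~~ ball e x z) sd f x y z.
  rewrite QE -adjacent_terms mulr_sumr -!big_split.
  apply: eq_bigr => y exy; rewrite (neighbour_split _ exy) /=.
  by congr (_ + _ + _); rewrite /sqr_second_diff; ring.
have -> : \sum_(y | e x y) \sum_(z | e x z) (f y - f z) ^+ 2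
  = \sum_(y | e x y) \sum_(z | e x z && e y z) (f y - f z) ^+ 2
    + \sum_(y | e x y) \sum_(z | e x z && ~~ ball e y z) (f y - f z) ^+ 2.
  rewrite -big_split; apply: eq_bigr => y exy.
  rewrite (@neighbour_split _ y x) 1?es // subrr expr0n /= add0r.
  by congr (_ + _); apply: eq_bigl => z; rewrite andbC.
have W_ge0 : 0 <= \sum_(y | e x y) \sum_(z | e x z && e y z) (f y - f z) ^+ 2.
  by do 2 (apply: sumr_ge0 => ? _); apply: sqr_ge0.
have := nonadjacent_terms f x; lra.
Qed.

End LowerBound.

(** The test function is 0 at [x], 1 on the neighbours of [x] and 2 elsewhere:
its second differences vanish along the walks that reach distance 2, and so do
the subtracted differences between neighbours of [x]. *)
Lemma BE_bounds_le x : ubound (BE_bounds e D x) ((4 + t) / (2 * D%:R)).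
Proof.
move=> K /(_ (fun u => if u == x then 0 else if e x u then 1 else 2)).
set f := fun u => _; rewrite (Gamma2E D_neq0 degree) GammaE //.
have fx : f x = 0 by rewrite /f eqxx.
have f1 u : e x u -> f u = 1.
  by rewrite /f => exu; case: eqVneq exu => [->|_ ->//]; rewrite ei.
have -> : \sum_(y | e x y) (f y - f x) * (f y - f x) = D%:R.
  by rewrite -(degree x); apply: eq_bigr => y /f1 ->; rewrite fx subr0 mulr1.
rewrite [X in _ - X]big1 => [|y /f1 fy]; last first.
  by rewrite big1 // => z /f1 ->; rewrite fy subrr expr0n.
have -> : \sum_(y | e x y) \sum_(z | e y z) sd f x y z = D%:R * (4 + t).
  rewrite -(degree x) mulr_suml; apply: eq_bigr => y exy.
  rewrite mul1r (neighbour_split _ exy) [X in _ + X]big1.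
    rewrite addr0 -(common exy); congr (_ + _).
      by rewrite /sqr_second_diff fx f1 //; ring.
    apply: eq_bigr => z /andP [exz _].
    by rewrite /sqr_second_diff fx !f1 //; ring.
  move=> z /andP [_]; rewrite /ball negb_or => /andP [/negbTE zx /negbTE exz].
  by rewrite /sqr_second_diff fx (f1 y) // /f zx exz; ring.
have -> : K * ((2 * D%:R)^-1 * D%:R) = K / 2 by field.
have -> : (4 * D%:R ^+ 2)^-1 * (D%:R * (4 + t) - 0) = (4 + t) / (2 * D%:R) / 2.
  by field.
by rewrite ler_pM2r // invr_gt0.
Qed.

(** Double count the pairs of a triangle at [x] and one of its two other
vertices [y]; for fixed [y] the triangles correspond to the common neighbours
of [x] and [y]. *)
Lemma card_triangles x : 2 * #|triangles e x|%:R = D%:R * t.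
Proof.
have tri A : A \in triangles e x ->
    [/\ x \in A, #|A :\ x| = 2%N & forall y z, y \in A -> z \in A -> y != z -> e y z].
  rewrite inE => /and3P [xA /eqP A3 /'forall_in_forallP cl]; split=> //.
    by move: A3; rewrite (cardsD1 x) xA add1n => -[].
  by move=> y z yA zA; apply/implyP; exact: (implyP (cl y yA z) zA).
have -> : 2 * #|triangles e x|%:R = \sum_(A in triangles e x) \sum_(y in A :\ x) 1 :> R.
  rewrite (eq_bigr (fun=> 2)) => [|A /tri [_ A2 _]]; last by rewrite sumr_const A2.
  by rewrite sumr_const mulr_natr.
rewrite (exchange_big_dep (e x)) /=; last first.
  by move=> A y /tri [xA _ cl]; rewrite !inE => /andP [yx yA]; rewrite cl // eq_sym.
rewrite -(degree x) mulr_suml; apply: eq_bigr => y exy; rewrite mul1r -(common exy).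
rewrite !sumr_const; congr (_ *+ _).
pose third u : {set V} := x |: (y |: [set u]).
have xy : x != y by apply: contraTneq exy => ->; rewrite ei.
rewrite -[RHS](@card_in_imset _ _ third); last first.
  move=> u v; rewrite !unfold_in => /andP [exu eyu] /andP [exv eyv] /setP /(_ u).
  rewrite !inE eqxx !orbT.
  case: eqVneq exu => [->|_ _]; rewrite ?ei //.
  by case: eqVneq eyu => [->|_ _]; rewrite ?ei //= => /esym/eqP.
apply: eq_card => A; apply/idP/imsetP.
  rewrite unfold_in => /andP [/tri [xA A2 cl]]; rewrite !inE => /andP [yx yA].
  have : #|A :\ x :\ y| == 1%N by move: A2; rewrite (cardsD1 y) !inE yx yA add1n => -[->].
  move=> /cards1P [u Au]; have : u \in A :\ x :\ y by rewrite Au set11.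
  rewrite !inE => /and3P [uy ux uA]; exists u.
    by rewrite unfold_in !cl // eq_sym.
  by rewrite /third -Au !finset.setD1K // !inE yx.
move=> [u]; rewrite unfold_in => /andP [exu eyu] ->.
have xu : x != u by apply: contraTneq exu => ->; rewrite ei.
have yu : y != u by apply: contraTneq eyu => ->; rewrite ei.
rewrite unfold_in /= !inE !eqxx /= (eq_sym y x) xy orbT !andbT.
apply/andP; split; first by rewrite !cardsU1 !inE cards1 negb_or xy xu yu.
apply/'forall_in_forallP => a; rewrite !inE => /or3P aA b.
apply/implyP; rewrite !inE => /or3P bA; apply/implyP.
by case: aA bA => /eqP -> [] /eqP ->; rewrite ?eqxx // 1?es.
Qed.

End LocalStructure.

Theorem theorem1p8 (R : realType) (V : finType) (e : rel V) (D L : nat)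
  (e_graph : connected_graph e)
  (e_self_centered : self_centered e)
  (e_sharp : Bonnet_Myers_sharp e R D L) :
  (forall x : V, BE_curvature_sharp e R D x) /\
  (forall x : V, is_BE_curvature e D x (D%:R^-1 + L%:R^-1 : R)).
Proof.
have [es ei _ _] := e_graph.
have D0 : D%:R != 0 :> R by rewrite pnatr_eq0 -lt0n (D_gt0 e_graph e_sharp).
have L0 : L%:R != 0 :> R by rewrite pnatr_eq0 -lt0n (L_gt0 e_graph e_sharp).
have degree := degreeE e_sharp.
have common := common_neighbours e_graph e_sharp e_self_centered.
pose t : R := 2 * D%:R / L%:R - 2.
have curvature x : is_BE_curvature e D x ((4 + t) / (2 * D%:R)).
  split; last exact: (BE_bounds_le es ei D0 degree common).
  move=> f; apply: (Gamma2_ge es ei D0 degree common).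
    exact: edge_square_exists e_graph e_sharp e_self_centered.
  exact: edge_square_unique e_graph e_sharp e_self_centered.
split=> x.
  rewrite /BE_curvature_sharp.
  have -> : 2 / D%:R + #|triangles e x|%:R / D%:R ^+ 2 = (4 + t) / (2 * D%:R).
    have -> : #|triangles e x|%:R = D%:R * t / 2.
      by rewrite -(card_triangles es ei degree common x); field.
    by field.
  exact: curvature.
have -> : D%:R^-1 + L%:R^-1 = (4 + t) / (2 * D%:R) :> R.
  by rewrite /t; field; rewrite ?L0 ?D0.
exact: curvature.
Qed.
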